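(* Let $\kappa\geq\omega$ be a cardinal and consider the complete Boolean algebra $P(\kappa)$. Then: (a) $\lim_{\mathcal{O}_{\mathrm{lsi}}}=\lambda_{\mathrm{s}}$; (b) $\tau_{\mathbb{C}_\kappa}$ is the minimal topology containing $\tau_{\mathbb{A}_\kappa}$ and $\tau_{\mathbb{A}_\kappa^c}$; (c) $\tau_{\mathbb{C}_\kappa}\subseteq\mathcal{O}_{\mathrm{lsi}}$, and $\mathcal{O}_{\mathrm{lsi}}$ is a Hausdorff topology on $P(\kappa)$; (d) for $\kappa=\omega$ we have $\mathcal{O}_{\mathrm{lsi}}=\tau_{\mathbb{C}_\omega}=\mathcal{O}_{\lambda_{\mathrm{s}}}$; (e) $\mathcal{O}_{\mathrm{lsi}}=\tau_{\mathbb{C}_\kappa}$ if and only if $\kappa=\omega$.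
   Context: A convergence on a non-empty set $X$ is a map $\lambda:X^\omega\to P(X)$. For convergences, $\lambda_1\leq\lambda_2$ means $\lambda_1(x)\subseteq\lambda_2(x)$ for all $x\in X^\omega$. For a topology $\mathcal{O}$ on $X$, $\lim_{\mathcal{O}}$ is the convergence for which $\lim_{\mathcal{O}}(x)$ is the set of all $a\in X$ such that each neighborhood of $a$ contains all but finitely many members of the sequence $x$. For each convergence $\lambda$, $\mathcal{O}_\lambda$ denotes the (unique) maximal topology $\mathcal{O}$ on $X$ with $\lambda\leq\lim_{\mathcal{O}}$. On a complete Boolean algebra $\mathbb{B}$, for $x=\langle x_n:n\in\omega\rangle\in\mathbb{B}^\omega$ let $\liminf x=\bigvee_{k\in\omega}\bigwedge_{n\geq k}x_n$ and $\limsup x=\bigwedge_{k\in\omega}\bigvee_{n\geq k}x_n$, and define convergences on $\mathbb{B}$ by $\lambda_{\mathrm{ls}}(x)=\{b\in\mathbb{B}: b\geq\limsup x\}$, $\lambda_{\mathrm{li}}(x)=\{b\in\mathbb{B}: b\leq\liminf x\}$, and $\lambda_{\mathrm{s}}(x)=\{a\}$ if $\liminf x=\limsup x=a$, while $\lambda_{\mathrm{s}}(x)=\emptyset$ if $\liminf x<\limsup x$. The topology $\mathcal{O}_{\mathrm{lsi}}$ is the minimal topology on $\mathbb{B}$ containing $\mathcal{O}_{\lambda_{\mathrm{ls}}}\cup\mathcal{O}_{\lambda_{\mathrm{li}}}$. Here these notions are applied to $\mathbb{B}=P(\kappa)$ ordered by inclusion. Identify $P(\kappa)$ with $2^\kappa=\{0,1\}^\kappa$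 via characteristic functions. Then $\tau_{\mathbb{A}_\kappa}$ (Alexandrov cube), $\tau_{\mathbb{A}_\kappa^c}$ (reversed Alexandrov cube) and $\tau_{\mathbb{C}_\kappa}$ (Cantor cube) are the topologies on $P(\kappa)$ corresponding to the Tychonoff product topology on $2^\kappa$ of $\kappa$ many copies of the two-point space $\{0,1\}$ with, respectively, the topology $\{\emptyset,\{0\},\{0,1\}\}$, the topology $\{\emptyset,\{1\},\{0,1\}\}$, and the discrete topology. *)

(* Defs.v *)
From HB Require Import structures.
From mathcomp Require Import all_boot all_order all_algebra.
From mathcomp Require Import all_classical.
From mathcomp Require Import reals topology measure.

Set Implicit Arguments.
Unset Strict Implicit.
Unset Printing Implicit Defensive.

Local Open Scope classical_set_scope.

(* Different topologies on one carrier have to be compared, so a topology is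
   its family of open sets.  The empty set is the union over [F = set0]. *)
Definition is_topology (X : Type) (O : set (set X)) :=
  [/\ O setT, setI_closed O
    & forall F : set (set X), F `<=` O -> O (\bigcup_(A in F) A)].

Definition generated_topology (X : Type) (G : set (set X)) : set (set X) :=
  smallest (@is_topology X) G.

Lemma generated_is_topology (X : Type) (G : set (set X)) :
  is_topology (generated_topology G).
Proof.
split => [M [[]] //|A B gA gB M MP|F FG M MP].
  by have [[_ MI _] _] := MP; apply: MI; [exact: gA|exact: gB].
by have [[_ _ MU] _] := MP; apply: MU => A /FG; apply.
Qed.

(* [X] seen as a library topological space whose open sets are those of [O]. *)
Definition with_topology (X : Type) (O : set (set X)) (hO : is_topology O) : Type :=
  X.

Section WithTopology.
Variables (X : choiceType) (O : set (set X)) (hO : is_topology O).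

Let opT : O setT. Proof. by case: hO. Qed.

Let opI : setI_closed O. Proof. by case: hO. Qed.

Let op_bigU (I : Type) (f : I -> set X) :
  (forall i, O (f i)) -> O (\bigcup_i f i).
Proof.
move=> Of; have [_ _ OU] := hO.
have := OU (range f); rewrite bigcup_image; apply.
by move=> _ [i _ <-]; exact: Of.
Qed.

HB.instance Definition _ := Choice.copy (with_topology hO) X.
HB.instance Definition _ :=
  isOpenTopological.Build (with_topology hO) opT opI op_bigU.

Lemma open_with_topology : @open (with_topology hO) = O.
Proof. by []. Qed.

End WithTopology.

Definition convergence (X : Type) := (nat -> X) -> set X.

Definition le_conv (X : Type) (l1 l2 : convergence X) :=
  forall x, l1 x `<=` l2 x.

Definition lim_conv (X : Type) (O : set (set X)) : convergence X :=
  fun x => [set a | forall U, nbhs_of_open O a U -> \forall n \near \oo, U (x n)].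

Section ConvTopology.
Variables (X : Type) (l : convergence X).

Definition compatible_topology (O : set (set X)) :=
  is_topology O /\ le_conv l (lim_conv O).

Definition maximal_compatible_topology (O : set (set X)) :=
  compatible_topology O /\
  forall O', compatible_topology O' -> O `<=` O' -> O' = O.

(* The default value [set0] is never used: see [conv_topologyP]. *)
Definition conv_topology : set (set X) :=
  xget set0 maximal_compatible_topology.

Let seq_open : set (set X) := [set A |
  forall x a, l x a -> A a -> \forall n \near \oo, A (x n)].

Let seq_open_compatible : compatible_topology seq_open.
Proof.
split; first split.
- by move=> x a _ _; exact: nearW.
- move=> A B oA oB x a lxa [Aa Ba].
  by apply: filterI; [exact: oA lxa Aa|exact: oB lxa Ba].
- move=> F FO x a lxa [A FA Aa].
  by apply: filterS (FO _ FA x a lxa Aa) => n Axn; exists A.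
- by move=> x a lxa U [B [oB Ba BU]]; apply: filterS (oB _ _ lxa Ba) => n /BU.
Qed.

Let compatible_sub O : compatible_topology O -> O `<=` seq_open.
Proof.
by move=> [_ lO] A OA x a lxa Aa; apply: (lO _ _ lxa); exists A; split.
Qed.

Let maximalE O : maximal_compatible_topology O -> O = seq_open.
Proof.
move=> [cO maxO]; apply/esym/maxO; first exact: seq_open_compatible.
exact: compatible_sub.
Qed.

Lemma conv_topologyP : maximal_compatible_topology conv_topology.
Proof.
rewrite /conv_topology; apply: (@xgetPex _ _ maximal_compatible_topology).
exists seq_open; split; first exact: seq_open_compatible.
by move=> O' cO' sO'; apply/seteqP; split => //; exact: compatible_sub.
Qed.

Lemma conv_topology_unique O :
  maximal_compatible_topology O -> O = conv_topology.
Proof. by move=> /maximalE ->; rewrite (maximalE conv_topologyP). Qed.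

Lemma conv_topology_greatest O : compatible_topology O -> O `<=` conv_topology.
Proof. by rewrite (maximalE conv_topologyP); exact: compatible_sub. Qed.

End ConvTopology.

Definition lim_inf_set (T : Type) (F : nat -> set T) : set T :=
  \bigcup_k \bigcap_(n >= k) F n.

Definition lambda_ls (K : Type) : convergence (set K) :=
  fun x => [set b | lim_sup_set x `<=` b].

Definition lambda_li (K : Type) : convergence (set K) :=
  fun x => [set b | b `<=` lim_inf_set x].

Definition lambda_s (K : Type) : convergence (set K) :=
  fun x => [set a | lim_inf_set x = a /\ lim_sup_set x = a].

Definition O_lsi (K : Type) : set (set (set K)) :=
  generated_topology
    (conv_topology (@lambda_ls K) `|` conv_topology (@lambda_li K)).

Definition charfun (K : Type) (A : set K) : K -> bool := fun i => `[< A i >].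

(* The product topology on [2^K] of copies of the two-point space with open
   sets [O], transported to [P(K)] along the bijection [charfun]. *)
Definition cube_topology (K : Type) (O : set (set bool)) (hO : is_topology O) :
    set (set (set K)) :=
  [set @charfun K @^-1` U |
     U in @open (prod_topology (fun _ : K => with_topology hO))].

Definition sierpinski (b : bool) : set (set bool) :=
  [set set0; [set b]; setT].

Lemma sierpinski_is_topology b : is_topology (sierpinski b).
Proof.
split; first by right.
- move=> A B [[|]|] -> [[|]|] ->;
    rewrite ?set0I ?setI0 ?setTI ?setIT ?setIid;
    solve [by left; left | by left; right | by right].
- move=> F FO; have [FT|FT] := pselect (F setT).
    right; apply/seteqP; split => // c _; exists setT => //.
  have [Fb|Fb] := pselect (F [set b]).
    left; right; apply/seteqP; split => [c [A FA Ac]|c cb]; last by exists [set b].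
    by move: Ac; have [[|]|] := FO _ FA => AE; rewrite ?AE //; rewrite AE in FA.
  left; left; apply/seteqP; split => // c [A FA Ac].
  by move: Ac; have [[|]|] := FO _ FA => AE; rewrite ?AE //; rewrite AE in FA.
Qed.

Lemma discrete_is_topology (X : Type) : is_topology [set: set X].
Proof. by split. Qed.

Definition alexandrov_cube (K : Type) : set (set (set K)) :=
  @cube_topology K _ (sierpinski_is_topology false).

Definition rev_alexandrov_cube (K : Type) : set (set (set K)) :=
  @cube_topology K _ (sierpinski_is_topology true).

Definition cantor_cube (K : Type) : set (set (set K)) :=
  @cube_topology K _ (discrete_is_topology bool).

(* [K] would be inferred from an element, since [set] unfolds to an arrow. *)
Arguments lambda_ls : clear implicits.
Arguments lambda_li : clear implicits.
Arguments lambda_s : clear implicits.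
Arguments O_lsi : clear implicits.
Arguments alexandrov_cube : clear implicits.
Arguments rev_alexandrov_cube : clear implicits.
Arguments cantor_cube : clear implicits.

(* Main.v *)
(* [O_lsi K] lies between the Cantor topology, whose convergent sequences
   converge pointwise, and [conv_topology (lambda_s K)]; as [lambda_s] is
   pointwise convergence, this gives (a), and (c) follows as well.
   When [K] is enumerated as [e 0, e 1, ...],
   the cylinders on the first [n] coordinates form a countable Cantor base at
   each point, so [lambda_s]-open sets are Cantor open.  When [K] is
   uncountable, the family of cocountable sets is upward closed and stable
   under [limsup], so its complement is [lambda_ls]-open; it contains the empty
   set but no cofinite set, hence no Cantor neighbourhood of the empty set. *)
Require Import Defs.
From mathcomp Require Import all_boot all_order all_algebra.
From mathcomp Require Import all_classical.
From mathcomp Require Import reals topology measure.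

Local Open Scope classical_set_scope.

(** * Topologies generated by a family or by a convergence *)

Lemma generated_topology_sub {X : Type} (G T : set (set X)) :
  is_topology T -> G `<=` T -> generated_topology G `<=` T.
Proof. exact: smallest_sub. Qed.

(** The sets passing this sequential test form a compatible topology, and every open set of a
    compatible topology passes it. Openness thus becomes a condition on sequences. *)
Lemma conv_topologyE {X : Type} (l : convergence X) :
  conv_topology l = [set A |
    forall x a, l x a -> A a -> \forall n \near \oo, A (x n)].
Proof.
apply/seteqP; split => [A oA x a lxa Aa|].
  by apply: ((conv_topologyP l).1.2 _ _ lxa); exists A; split.
apply: conv_topology_greatest; split; first split.
- by move=> x a _ _; exact: nearW.
- move=> A B oA oB x a lxa [Aa Ba].
  by apply: filterI; [exact: oA lxa Aa|exact: oB lxa Ba].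
- move=> F FO x a lxa [A FA Aa].
  by apply: filterS (FO _ FA x a lxa Aa) => n Axn; exists A.
- by move=> x a lxa U [B [oB Ba BU]]; apply: filterS (oB _ _ lxa Ba) => n /BU.
Qed.

Lemma conv_topology_is_topology {X : Type} (l : convergence X) :
  is_topology (conv_topology l).
Proof. exact: (conv_topologyP l).1.1. Qed.

(** * Cube topologies through their coordinate subbase *)

Definition cube_subbase (K : Type) (O : set (set bool)) : set (set (set K)) :=
  [set S | exists i V, O V /\ S = [set A | V (charfun A i)]].

Lemma cube_subbaseS (K : Type) (O1 O2 : set (set bool)) :
  O1 `<=` O2 -> cube_subbase K O1 `<=` cube_subbase K O2.
Proof. by move=> sO S [i [V [/sO OV ->]]]; exists i, V. Qed.

Section CubeTopology.
Context {K : Type} {O : set (set bool)} (hO : is_topology O).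

Let cube := prod_topology (fun _ : K => with_topology hO).

Lemma cube_topology_is_topology : is_topology (@cube_topology K O hO).
Proof.
split.
- by exists setT => //; exact: openT.
- by move=> _ _ [U oU <-] [V oV <-]; exists (U `&` V) => //; exact: openI.
- move=> F FO; exists (\bigcup_(U in [set U : set cube |
    open U /\ F (@charfun K @^-1` U)]) U).
    by apply: bigcup_open => U [].
  apply/seteqP; split => [A [U [oU FU] UA]|A [S FS SA]].
    by exists (@charfun K @^-1` U).
  by have [U oU US] := FO _ FS; exists U; [rewrite /= US|rewrite -US in SA].
Qed.

Lemma coordinate_open (i : K) (V : set bool) :
  O V -> open [set f : cube | V (f i)].
Proof.
move=> OV; rewrite openE => f Vfi; rewrite /interior.
(* The product topology is the supremum of the initial topologies of the projections, so
   neighbourhoods for projection [i] are neighbourhoods in the cube. *)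
have /cvg_sup /(_ i) : nbhs f --> f by exact: cvg_id.
apply; apply: (@open_nbhs_nbhs (initial_topology (fun f : cube => f i))).
by split => //; exists V.
Qed.

Lemma cube_topologyE :
  @cube_topology K O hO = generated_topology (cube_subbase K O).
Proof.
apply/seteqP; split; last first.
  apply: generated_topology_sub; first exact: cube_topology_is_topology.
  move=> _ [i [V [OV ->]]]; exists [set f : cube | V (f i)] => //.
  exact: coordinate_open.
have hT := generated_is_topology (cube_subbase K O).
pose T := with_topology hT.
(* The remaining inclusion says that [charfun] is continuous from the generated topology, which can
   be tested one projection at a time. *)
suff /continuousP c : continuous (@charfun K : T -> cube).
  by move=> _ [U oU <-]; exact: c.
move=> A; have FA : Filter (@charfun K @ nbhs (A : T)) by exact: fmap_filter.
apply/cvg_sup => i U.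
rewrite (@nbhsE (initial_topology (fun f : cube => f i))).
move=> [_ [[V oV <-] VAi] VU].
apply: (@filterS _ (nbhs (A : T)) _ [set B | V (charfun B i)]).
  by move=> B VBi; exact: VU.
apply: open_nbhs_nbhs; split => //.
by apply: sub_gen_smallest; exists i, V.
Qed.

End CubeTopology.

(** * The Cantor cube against the two Alexandrov cubes *)

Section Cubes.
Context {K : Type}.
Implicit Types (A a : set K) (x : nat -> set K) (i : K).

Lemma charfunE A i b : charfun A i = b <-> (if b then A i else ~ A i).
Proof.
rewrite /charfun; case: b; first by split => /asboolP.
by split => [/asboolPn|/asboolPn/negbTE].
Qed.

Lemma charfun_inj : injective (@charfun K).
Proof.
move=> A B eqAB; apply/funext => i; rewrite -[LHS]asboolE -[RHS]asboolE.
by have /(congr1 (@^~ i)) := eqAB; rewrite /charfun => ->.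
Qed.

Lemma sub_cantor_cube {O : set (set bool)} (hO : is_topology O) :
  @cube_topology K O hO `<=` cantor_cube K.
Proof.
rewrite /cantor_cube !cube_topologyE.
apply: sub_smallest2r; first exact: generated_is_topology.
exact: cube_subbaseS.
Qed.

Lemma cantor_cubeE : cantor_cube K =
  generated_topology (alexandrov_cube K `|` rev_alexandrov_cube K).
Proof.
apply/seteqP; split; last first.
  apply: generated_topology_sub; first exact: cube_topology_is_topology.
  by move=> S [|]; exact: sub_cantor_cube.
rewrite /cantor_cube cube_topologyE.
set G := _ `|` _; have gT := generated_is_topology G.
apply: generated_topology_sub => // S [i [V [_ ->]]]; have [_ _ gU] := gT.
(* A condition on coordinate [i] is a union of conditions fixing its bit; bit 0 is open in the
   Alexandrov cube, bit 1 in the reversed one. *)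
suff gb b : generated_topology G [set A | charfun A i = b].
  rewrite (_ : mkset _ =
    \bigcup_(S in [set [set A | charfun A i = b] | b in V]) S).
    by apply: gU => _ [b _ <-].
  apply/seteqP; split => [A VA|A [_ [b Vb <-] /= ->]] //.
  by exists [set B | charfun B i = charfun A i] => //; exists (charfun A i).
apply: sub_gen_smallest.
rewrite /G /alexandrov_cube /rev_alexandrov_cube !cube_topologyE.
by case: b; [right|left]; apply: sub_gen_smallest;
  [exists i, [set true]|exists i, [set false]]; split => //; left; right.
Qed.

Lemma cantor_coordinate_open i b : cantor_cube K [set A | charfun A i = b].
Proof.
rewrite /cantor_cube cube_topologyE; apply: sub_gen_smallest.
by exists i, [set b].
Qed.

(** * Bounds on [O_lsi] and its limits *)

Lemma alexandrov_sub_ls : alexandrov_cube K `<=` conv_topology (lambda_ls K).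
Proof.
rewrite /alexandrov_cube cube_topologyE.
apply: generated_topology_sub; first exact: conv_topology_is_topology.
move=> _ [i [V [OV ->]]]; rewrite conv_topologyE => x a ls_xa.
case: OV => [[|]|] -> //=; last by move=> _; exact: nearW.
(* Since [i] is not in [a], it is not in the limsup either, so all late terms miss it. *)
move=> /charfunE nai; have /existsNP[k nk] : ~ lim_sup_set x i by move=> /ls_xa.
exists k => // n /= kn; apply/charfunE => xni.
by apply: nk => _; exists n.
Qed.

(** Dually, an element of [a] lies in the liminf, hence in all late terms. *)
Lemma rev_alexandrov_sub_li :
  rev_alexandrov_cube K `<=` conv_topology (lambda_li K).
Proof.
rewrite /rev_alexandrov_cube cube_topologyE.
apply: generated_topology_sub; first exact: conv_topology_is_topology.
move=> _ [i [V [OV ->]]]; rewrite conv_topologyE => x a li_xa.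
case: OV => [[|]|] -> //=; last by move=> _; exact: nearW.
move=> /charfunE /li_xa[k _ kx].
by exists k => // n /= kn; apply/charfunE; exact: kx.
Qed.

Lemma cantor_sub_lsi : cantor_cube K `<=` O_lsi K.
Proof.
rewrite cantor_cubeE; apply: sub_smallest2r; first exact: generated_is_topology.
by apply: setUSS; [exact: alexandrov_sub_ls|exact: rev_alexandrov_sub_li].
Qed.

(** [lambda_s] is below both [lambda_ls] and [lambda_li], and a smaller convergence has more open
    sets. *)
Lemma lsi_sub_s : O_lsi K `<=` conv_topology (lambda_s K).
Proof.
apply: generated_topology_sub; first exact: conv_topology_is_topology.
rewrite !conv_topologyE => S [|] oS x a [li_xa ls_xa] Sa.
  by apply: (oS x a) => //; rewrite /lambda_ls /= ls_xa.
by apply: (oS x a) => //; rewrite /lambda_li /= li_xa.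
Qed.

(** Elements of [a] lie in all late terms, and elements of the limsup in some late term, where
    membership agrees with [a]. So [a] is below the liminf and above the limsup. *)
Lemma lambda_s_pointwise x a :
  (forall i, \forall n \near \oo, charfun (x n) i = charfun a i) ->
  lambda_s K x a.
Proof.
move=> xa; have eqA n i : charfun (x n) i = charfun a i -> x n i <-> a i.
  move=> xai; split => /(charfunE _ _ true).
    by rewrite xai => /charfunE.
  by rewrite -xai => /charfunE.
have li_ls : lim_inf_set x `<=` lim_sup_set x.
  move=> i [k _ kx] m _; exists (maxn k m); first exact: leq_maxr.
  exact/kx/leq_maxl.
have a_li : a `<=` lim_inf_set x.
  by move=> i ai; have [k _ kx] := xa i; exists k => // n /kx /eqA [_]; apply.
have ls_a : lim_sup_set x `<=` a.
  move=> i xi; have [k _ kx] := xa i.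
  by have [n /kx /eqA [+ _]] := xi k I; apply.
split; apply/seteqP; split => //; first exact: subset_trans ls_a.
exact: subset_trans li_ls.
Qed.

Lemma lim_lsiE : lim_conv (O_lsi K) = lambda_s K.
Proof.
apply/funext => x; apply/seteqP; split => a.
  move=> xa; apply: lambda_s_pointwise => i.
  suff /xa : nbhs_of_open (O_lsi K) a [set A | charfun A i = charfun a i] by [].
  exists [set A | charfun A i = charfun a i]; split => //.
  by apply: cantor_sub_lsi; exact: cantor_coordinate_open.
move=> xa U [B [/lsi_sub_s + Ba BU]]; rewrite conv_topologyE => oB.
by apply: filterS (oB x a xa Ba) => n /BU.
Qed.

(** Distinct sets differ at some coordinate, whose two values give disjoint open sets. *)
Lemma cantor_finer_hausdorff {O : set (set (set K))} (hO : is_topology O) :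
  cantor_cube K `<=` O -> hausdorff_space (with_topology hO).
Proof.
move=> cO; rewrite open_hausdorff => A B /eqP neAB.
have [i neABi] : exists i, charfun A i <> charfun B i.
  by apply/existsNP => eqAB; apply/neAB/charfun_inj/funext.
exists ([set C : set K | charfun C i = charfun A i],
        [set C : set K | charfun C i = charfun B i]).
  by rewrite !inE.
split; try by apply: cO; exact: cantor_coordinate_open.
apply/eqP/seteqP; split => //= C [/= CA CB].
by apply: neABi; rewrite -CA.
Qed.

(** * The countable case *)

Lemma cantor_cylinder_open (e : nat -> K) a n :
  cantor_cube K
    [set b | forall m, (m < n)%N -> charfun b (e m) = charfun a (e m)].
Proof.
have [cT cI _] : is_topology (cantor_cube K) by exact: cube_topology_is_topology.
elim: n => [|n IHn]; first by rewrite (_ : mkset _ = setT) //; apply/seteqP.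
rewrite (_ : mkset _ = [set b | charfun b (e n) = charfun a (e n)] `&`
    [set b | forall m, (m < n)%N -> charfun b (e m) = charfun a (e m)]).
  by apply: cI IHn; exact: cantor_coordinate_open.
apply/seteqP; split => [b ba|b [/= bn ba] m].
  by split => [|m mn]; apply: ba => //; exact: ltnW.
by rewrite ltnS leq_eqVlt => /orP[/eqP ->|/ba].
Qed.

Lemma s_sub_cantor (e : nat -> K) :
  range e = setT -> conv_topology (lambda_s K) `<=` cantor_cube K.
Proof.
move=> esurj U; rewrite conv_topologyE => oU.
pose cyl a n :=
  [set b | forall m, (m < n)%N -> charfun b (e m) = charfun a (e m)].
(* Otherwise, picking a point outside [U] in each cylinder around [a] gives a sequence converging
   pointwise to [a] but avoiding [U]. *)
have cylU a : U a -> exists n, cyl a n `<=` U.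
  move=> Ua; apply: contrapT => /forallNP ncyl.
  have /choice[x xP] : forall n, exists b, cyl a n b /\ ~ U b.
    by move=> n; have /existsNP[b /not_implyP] := ncyl n; exists b.
  suff /(oU x a) /(_ Ua)[k _ kU] : lambda_s K x a.
    exact: (xP k).2 (kU k (leqnn k)).
  apply: lambda_s_pointwise => i; have [m _ <-] : range e i by rewrite esurj.
  (* Coordinate [e m] is fixed only by the cylinders of length greater than [m]. *)
  by exists m.+1 => // n /= mn; exact: (xP n).1.
have [_ _ cU] : is_topology (cantor_cube K) by exact: cube_topology_is_topology.
rewrite (_ : U = \bigcup_(S in
    [set S | S `<=` U /\ exists a n, S = cyl a n]) S).
  by apply: cU => _ [_ [a [n ->]]]; exact: cantor_cylinder_open.
apply/seteqP; split => [a Ua|a [S [SU _]]]; last exact: SU.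
by have [n anU] := cylU a Ua; exists (cyl a n) => //; split => //; exists a, n.
Qed.

Lemma lsi_cantor_s (e : nat -> K) : range e = setT ->
  O_lsi K = cantor_cube K /\ cantor_cube K = conv_topology (lambda_s K).
Proof.
move=> /s_sub_cantor sc; split; apply/seteqP; split.
- exact: subset_trans lsi_sub_s sc.
- exact: cantor_sub_lsi.
- exact: subset_trans cantor_sub_lsi lsi_sub_s.
- exact: sc.
Qed.

(** * The uncountable case *)

Lemma cantor_nbhs_set0 (U : set (set K)) : cantor_cube K U -> U set0 ->
  exists2 F : set K, finite_set F & U (~` F).
Proof.
(* Asking for all sets disjoint from [F], not just its complement, makes the property stable under
   intersection. *)
pose T := [set U : set (set K) | U set0 -> exists2 F : set K,
  finite_set F & forall A, A `&` F = set0 -> U A].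
suff cT : cantor_cube K `<=` T.
  by move=> /cT TU /TU[F finF FU]; exists F => //; apply: FU; rewrite setICl.
rewrite /cantor_cube cube_topologyE; apply: generated_topology_sub; first split.
- by move=> _; exists set0.
- move=> V W TV TW [/TV[F finF FV] /TW[G finG GW]].
  exists (F `|` G); first by rewrite finite_setU.
  by move=> A; rewrite setIUr setU_eq0 => -[/FV ? /GW].
- move=> FF sFT [V FV V0]; have [F finF FA] := sFT _ FV V0.
  by exists F => // A /FA; exists V.
- move=> _ [i [V [_ ->]]] V0; exists [set i] => // A Ai0 /=.
  suff -> : charfun A i = charfun set0 i by [].
  transitivity false; last by apply/esym/charfunE.
  by apply/charfunE => Ai; have : (A `&` [set i]) i by []; rewrite Ai0.
Qed.

Lemma uncountable_compl_ls_open :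
  conv_topology (lambda_ls K) [set A | ~ countable (~` A)].
Proof.
rewrite conv_topologyE => x a ls_xa /= nca.
apply: contrapT => nx; apply: nca.
(* If the terms are not eventually in the set, terms with countable complement occur arbitrarily
   late. A point lying in all the chosen [x (f k)] is in the limsup, hence in [a], so the complement
   of [a] is covered by countably many countable sets. *)
have /choice[f fP] : forall k, exists n, (k <= n)%N /\ countable (~` x n).
  move=> k; apply: contrapT => /forallNP nk; apply: nx.
  by exists k => // n /= kn cxn; exact: (nk n).
have : countable (\bigcup_k ~` x (f k)).
  by apply: bigcup_countable => // k _; exact: (fP k).2.
apply/sub_countable/subset_card_le => i nai; apply: contrapT => nfi.
apply/nai/ls_xa => k _; exists (f k); first exact: (fP k).1.
by apply: contrapT => nxi; apply: nfi; exists k.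
Qed.

Lemma lsi_cantor_countable : O_lsi K `<=` cantor_cube K -> countable [set: K].
Proof.
move=> lc; apply: contrapT => ncK.
have /lc/cantor_nbhs_set0[|F finF] : O_lsi K [set A | ~ countable (~` A)].
- by apply: sub_gen_smallest; left; exact: uncountable_compl_ls_open.
- by rewrite /= setC0.
- by rewrite /= setCK; apply; exact: finite_set_countable.
Qed.

End Cubes.

Lemma card_eq_nat_range {K : Type} :
  ([set: K] #= [set: nat])%card -> exists e : nat -> K, range e = setT.
Proof.
move=> /card_set_bijP[f [_ finj fsurj]].
have /choice[e eK] : forall n, exists i, f i = n.
  by move=> n; have [i _ fi] := fsurj n I; exists i.
exists e; apply/seteqP; split => // i _.
by exists (f i) => //; apply: finj; rewrite ?inE.
Qed.

Theorem theorem3p4 (K : Type) (infK : infinite_set [set: K]) :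
  [/\ (* (a) *) lim_conv (O_lsi K) = lambda_s K,
      (* (b) *) cantor_cube K =
        generated_topology (alexandrov_cube K `|` rev_alexandrov_cube K),
      (* (c) *) cantor_cube K `<=` O_lsi K /\
        exists hO : is_topology (O_lsi K), hausdorff_space (with_topology hO),
      (* (d) *) ([set: K] #= [set: nat])%card ->
        O_lsi K = cantor_cube K /\ cantor_cube K = conv_topology (lambda_s K)
    & (* (e) *) O_lsi K = cantor_cube K <-> ([set: K] #= [set: nat])%card ].
Proof.
have d : ([set: K] #= [set: nat])%card ->
    O_lsi K = cantor_cube K /\ cantor_cube K = conv_topology (lambda_s K).
  by move=> /card_eq_nat_range[e]; exact: lsi_cantor_s.
split; [exact: lim_lsiE|exact: cantor_cubeE| |exact: d|].
  split; first exact: cantor_sub_lsi.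
  exists (generated_is_topology _).
  by apply: cantor_finer_hausdorff; exact: cantor_sub_lsi.
split => [lc|/d[]//].
(* The equality makes [K] countable, and [infK] then leaves only the cardinality of [nat]. *)
by apply: eq_card_nat => //; apply: lsi_cantor_countable; rewrite lc.
Qed.
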